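(* Let $N \ge 1$, let $\mathbf{P} = (p_{ij})$ be an irreducible transition matrix on $[N] = \{1,\dots,N\}$, and let $X_1,\dots,X_N$, with $X_l = (X_l(t): t = 0,1,2,\dots)$, be $N$ synchronized Markov chains on $[N]$, each with transition matrix $\mathbf{P}$, with arbitrary joint initial distribution $\rho$ on $[N]^N$ for $(X_1(0),\dots,X_N(0))$, and conditionally independent given $(X_1(0),\dots,X_N(0))$. Consider the algorithm $\mathcal{A}$ described in the context, with stopping time $\tau$ and output $S$. Then $\mathcal{A}$ is a terminating algorithm for interruptible exact tree-sampling; that is, for every such $\mathbf{P}$ and $\rho$: (1) (terminating) $P(\tau < \infty) = 1$; (2) (interruptible and exact) for every integer $k \ge 0$ and every $T \in \mathcal{T}$, $$P(\tau \le k,\ S = T) = P(\tau \le k)\,\frac{w(T)}{w}.$$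
   Context: Arborescences and the tree distribution: an arborescence on $[N]$ rooted at $r \in [N]$ is a spanning tree on vertex set $[N]$ with every edge directed towards $r$ (so every vertex other than $r$ has exactly one outgoing edge, and $r$ has none). For an irreducible transition matrix $\mathbf{P}=(p_{ij})$ on $[N]$, the weight of an arborescence $T$ is $w(T) = \prod_{(i\to j) \in T} p_{ij}$, the product over its $N-1$ directed edges. Let $\mathcal{T}$ be the set of all arborescences $T$ on $[N]$ (with any root) with $w(T) > 0$, and $w := \sum_{T\in\mathcal{T}} w(T)$. The tree distribution of the chain is the probability distribution $T \mapsto w(T)/w$ on $\mathcal{T}$. The algorithm $\mathcal{A}$: it observes $X_1,\dots,X_N$ and uses random numbers that are independent of each other and of the chains, each uniformly distributed on $[N]$. It proceeds in rounds $t = 2N, 4N, 6N, \dots$. In round $t$, fresh independent uniform random numbers $U_0, U_1, \dots, U_N$ on $[N]$ are generated, and the following events are defined: - $A_t := \bigcap_{l\in[N]} \{X_l(t-2N) = 1\}$; - $B_t := \{X_1(t-2N+U_0) = 1\}$; - $C_t$ is the event that $\{X_1(t-2N+U_0+U_1),\, X_2(t-2N+U_2),\dots, X_N(t-2N+U_N)\} = [N]$ as sets; - for $T\in\mathcal{T}$, $D_t(T)$ is the event that the graph with directed edges from $X_l(t-2N+U_l)$ to $X_l(t-2N+U_l+1)$, $2 \le l \le N$, is the arborescence $T$; - $E_t(T) := A_t\cap B_t\cap C_t\cap D_t(T)$ and $E_t := \bigcup_{T\in\mathcal{T}} E_t(T)$. The algorithm stops at the first round $t$ for which $E_t$ holds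 and then outputs $S := T$ for the unique $T\in\mathcal{T}$ such that $E_t(T)$ holds. Let $\tau$ be the value of $t$ at which the algorithm stops ($\tau = \infty$ if it never stops).
   Formalization: Part (1) is proved for aperiodic irreducible P only: for periodic P it fails for some initial distributions (N=2, p_12=p_21=1, both chains started at 2: A_t never occurs). Part (2) is proved for all irreducible P. *)

(* Defs.v *)
From HB Require Import structures.
From mathcomp Require Import all_boot all_order all_algebra.
From mathcomp Require Import all_classical all_reals all_analysis.

Set Implicit Arguments.
Unset Strict Implicit.
Unset Printing Implicit Defensive.

Import Order.TTheory GRing.Theory Num.Theory.
Local Open Scope classical_set_scope.
Local Open Scope ring_scope.

(* N is written n.+1, and [N] = {1, ..., N} is 'I_n.+1 : the ordinal i stands
   for the number i + 1, so the state 1 and the chain index 1 are both ord0. *)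

Section TransitionMatrix.
Context {R : realType} {n : nat}.
Implicit Type P : 'M[R]_n.+1.

Definition transition_matrix P : Prop :=
  (forall i j, 0 <= P i j) /\ (forall i, \sum_j P i j = 1).

Definition irreducible P : Prop :=
  forall i j, exists m : nat, 0 < (P ^+ m) i j.

Definition aperiodic P : Prop :=
  forall i (q : nat),
    (forall m : nat, (0 < m)%N -> 0 < (P ^+ m) i i -> (q %| m)%N) -> q = 1%N.

End TransitionMatrix.

(* A directed graph on [N] is its set of directed edges (i, j), i.e. i -> j. *)
Section Arborescence.
Context {n : nat}.
Implicit Type T : {set 'I_n.+1 * 'I_n.+1}.

Definition undirected T : rel 'I_n.+1 :=
  [rel i j | ((i, j) \in T) || ((j, i) \in T)].

(* Each edge carries a single direction; taken with i = j, the first clause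
   also excludes loops. *)
Definition spanning_tree T : Prop :=
  [/\ forall i j, (i, j) \in T -> (j, i) \notin T,
      forall i j, connect (undirected T) i j
    & forall c : seq 'I_n.+1, ucycle (undirected T) c -> (size c <= 2)%N].

(* i -> j is the first step of a simple path of the tree from i to r. *)
Definition directed_towards (r : 'I_n.+1) T : Prop :=
  forall i j, (i, j) \in T ->
  exists p : seq 'I_n.+1,
    [/\ path (undirected T) i (j :: p), uniq (i :: j :: p) & last j p = r].

Definition arborescence (r : 'I_n.+1) T : Prop :=
  spanning_tree T /\ directed_towards r T.

End Arborescence.

Section TreeDistribution.
Context {R : realType} {n : nat}.
Variable P : 'M[R]_n.+1.

Definition tree_weight (T : {set 'I_n.+1 * 'I_n.+1}) : R :=
  \prod_(e in T) P e.1 e.2.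

Definition trees : {set {set 'I_n.+1 * 'I_n.+1}} :=
  [set T | `[< exists r, arborescence r T >] && (0 < tree_weight T)]%SET.

Definition total_weight : R := \sum_(T in trees) tree_weight T.

End TreeDistribution.

Section Chains.
Context {R : realType} {n : nat} {d : measure_display} {Om : measurableType d}.
Variables (Pr : probability Om R) (P : 'M[R]_n.+1).
Variable X : 'I_n.+1 -> nat -> Om -> 'I_n.+1.

Definition cond_prob (A B : set Om) : R := fine (Pr (A `&` B)) / fine (Pr B).

Definition starts_at (v : {ffun 'I_n.+1 -> 'I_n.+1}) : set Om :=
  [set om | forall l, X l 0%N om = v l].

Definition follows (l : 'I_n.+1) (t : nat) (x : nat -> 'I_n.+1) : set Om :=
  [set om | forall s, (s <= t)%N -> X l s om = x s].

Definition joint_distribution (rho : {ffun 'I_n.+1 -> 'I_n.+1} -> R) : Prop :=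
  (forall v, 0 <= rho v) /\ \sum_v rho v = 1.

Definition initial_law (rho : {ffun 'I_n.+1 -> 'I_n.+1} -> R) : Prop :=
  forall v, Pr (starts_at v) = (rho v)%:E.

(* The Markov property is required given the whole vector (X_1(0), ..., X_N(0))
   and not only given X_l(0): otherwise the moves of one chain could be
   determined by the initial state of another. *)
Definition markov_chain (l : 'I_n.+1) : Prop :=
  forall v (t : nat) (x : nat -> 'I_n.+1) (j : 'I_n.+1),
    Pr (starts_at v `&` follows l t x) != 0%E ->
    cond_prob [set om | X l t.+1 om = j] (starts_at v `&` follows l t x)
      = P (x t) j.

Definition cond_independent_chains : Prop :=
  forall v, Pr (starts_at v) != 0%E ->
  forall (t : nat) (x : 'I_n.+1 -> nat -> 'I_n.+1),
    cond_prob (\bigcap_l follows l t (x l)) (starts_at v)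
      = \prod_l cond_prob (follows l t (x l)) (starts_at v).

(* U m j is the random number U_j of the (m + 1)-st round, 0 <= j <= N;
   its numerical value in {1, ..., N} is (U m j om).+1 . *)
Variable U : nat -> 'I_n.+2 -> Om -> 'I_n.+1.

Definition uniform_numbers : Prop :=
  forall m j i, Pr [set om | U m j om = i] = (n.+1%:R^-1)%:E.

(* All the random numbers, together with the family of chains, are mutually
   independent. *)
Definition independent_numbers : Prop :=
  forall (s : seq (nat * 'I_n.+2)) (u : nat * 'I_n.+2 -> 'I_n.+1)
         (t : nat) (x : 'I_n.+1 -> nat -> 'I_n.+1), uniq s ->
    Pr ([set om | forall p, p \in s -> U p.1 p.2 om = u p]
        `&` \bigcap_l follows l t (x l))
    = ((\prod_(p <- s) Pr [set om | U p.1 p.2 om = u p])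
        * Pr (\bigcap_l follows l t (x l)))%E.

End Chains.

(* The (m + 1)-st round, m = 0, 1, ..., is t = 2N(m + 1), so t - 2N = 2Nm. *)
Section Algorithm.
Context {R : realType} {n : nat} {Om : Type}.
Variable P : 'M[R]_n.+1.
Variable X : 'I_n.+1 -> nat -> Om -> 'I_n.+1.
Variable U : nat -> 'I_n.+2 -> Om -> 'I_n.+1.

Definition round_start (m : nat) : nat := (2 * n.+1 * m)%N.
Definition round_time (m : nat) : nat := (2 * n.+1 * m.+1)%N.

(* The numbers U_0 and U_l, l in [N], of a round. *)
Definition num0 (m : nat) (om : Om) : nat := (U m ord0 om).+1.
Definition num (m : nat) (l : 'I_n.+1) (om : Om) : nat :=
  (U m (lift ord0 l) om).+1.

Definition obs_time (m : nat) (l : 'I_n.+1) (om : Om) : nat :=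
  if l == ord0 then (round_start m + num0 m om + num m l om)%N
  else (round_start m + num m l om)%N.

Definition event_A (m : nat) (om : Om) : bool :=
  [forall l, X l (round_start m) om == ord0].

Definition event_B (m : nat) (om : Om) : bool :=
  X ord0 (round_start m + num0 m om) om == ord0.

Definition event_C (m : nat) (om : Om) : bool :=
  [set X l (obs_time m l om) om | l : 'I_n.+1]%SET == [set: 'I_n.+1]%SET.

Definition event_D (m : nat) (T : {set 'I_n.+1 * 'I_n.+1}) (om : Om) : bool :=
  [set (X l (round_start m + num m l om) om,
        X l (round_start m + num m l om).+1 om)
   | l : 'I_n.+1 & l != ord0]%SET == T.

Definition event_ET (m : nat) (T : {set 'I_n.+1 * 'I_n.+1}) (om : Om) : bool :=
  [&& event_A m om, event_B m om, event_C m om & event_D m T om].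

Definition event_E (m : nat) (om : Om) : bool :=
  [exists T in trees P, event_ET m T om].

Definition stopping_round (om : Om) : option nat :=
  match pselect (exists m, event_E m om) with
  | left h => Some (ex_minn h)
  | right _ => None
  end.

Definition tau (om : Om) : \bar R :=
  if stopping_round om is Some m then (round_time m)%:R%:E else +oo%E.

(* The output; None when the algorithm never stops. *)
Definition output (om : Om) : option {set 'I_n.+1 * 'I_n.+1} :=
  if stopping_round om is Some m then [pick T in trees P | event_ET m T om]
  else None.

End Algorithm.

(* Main.v *)
Require Import Defs.
From mathcomp Require Import all_boot all_order all_algebra.
From mathcomp Require Import all_classical all_reals all_analysis.
From mathcomp Require Import perm zify ring.

(** A round in which all chains start at state 1 produces T with probability
    proportional to w(T), and nothing that happened in earlier rounds changes
    this; conditioning on the round in which the algorithm stops is therefore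
    harmless.

    Let T be an arborescence rooted at r, that is, T = {(i, f i) : i <> r} for
    some function f.  Given event A, the round outputs T exactly when the states
    g 1, ..., g N observed in the N chains are a permutation of [N] with g 1 = r
    (the sources of the N - 1 recorded edges being the states other than r), when
    chain 1 is in state 1 at the time U_0, and when the chain l >= 2 moves from
    g l to f (g l) (lemma [event_ET_observed]).  The chains being independent, for
    given times this has probability a product over the chains, in which the
    transitions g l -> f (g l) contribute w(T) whatever g is.  Averaged over
    the times, the other factors are q_1 * \prod_l q_(g l) = q_1 * \prod_i q_i,
    where q_i is the mean over u = 1, ..., N of p^u(1, i): since chain 1 is
    restarted from state 1 at time U_0, all the N states are sampled from the same
    law q.  The number of permutations g with g 1 = r does not depend on r.  Hence
    for each event H of the past the probability of H together with the output
    of T in this round is c * w(T) * P(H and A), with c the same for all the rounds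
    and all T ([pr_event_ET]).

    Taking for H the event that no earlier round was successful and summing
    over the rounds ending by time k gives exactness ([exact_sampling]).

    For termination, aperiodicity makes the powers p^t(i, 1) positive for all
    large t, so that from any configuration event A holds some fixed number
    of rounds later with a probability bounded below; that round then succeeds
    with conditional probability c * w, and c > 0 because every state is within
    N steps of state 1.  The probability of not having stopped thus decays
    geometrically ([running_decay], [termination]).

    The probabilistic side rests on one device.  An event is called determined
    by m and s when it depends only on the random numbers of the first m
    rounds and, for each chain l, on its trajectory up to the time s l.  Since
    each chain has its own time horizon, the Markov property can be applied to one
    chain at a time ([markov_step], [markov_steps], [markov_chains]), even though
    the chains are observed at different random times. *)

Set Implicit Arguments.
Unset Strict Implicit.
Unset Printing Implicit Defensive.

Import Order.TTheory GRing.Theory Num.Theory.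
Local Open Scope classical_set_scope.
Local Open Scope ring_scope.

(** * Arborescences as graphs of functions *)

Section Trees.
Variable n : nat.
Implicit Types (T : {set 'I_n.+1 * 'I_n.+1}) (i j k r : 'I_n.+1).

Lemma undirected_sym T : symmetric (undirected T).
Proof. by move=> i j; rewrite /undirected /= orbC. Qed.

Definition avoiding T i : rel 'I_n.+1 :=
  [rel x y | [&& undirected T x y, x != i & y != i]].

Lemma avoiding_connect T i x p :
  path (undirected T) x p -> i \notin x :: p ->
  connect (avoiding T i) x (last x p).
Proof.
move=> xp ip; apply/connectP; exists p => //.
elim: p x xp ip => //= y p IH x /andP[xy yp].
rewrite !inE !negb_or => /and3P[ix iy ip].
apply/andP; split; last by apply: IH => //; rewrite inE negb_or iy.
by apply/and3P; split; rewrite // eq_sym.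
Qed.

(** Otherwise p, followed by q read backwards, joins j to k without visiting i,
    and so does a simple path; closing that path at i gives a cycle of at least
    three vertices. *)
Lemma first_step_unique T i j k p q :
  spanning_tree T ->
  path (undirected T) i (j :: p) -> uniq (i :: j :: p) ->
  path (undirected T) i (k :: q) -> uniq (i :: k :: q) ->
  last j p = last k q -> j = k.
Proof.
move=> [_ _ acyc] /= /andP[ij jp] /andP[ijp _] /andP[ik kq] /andP[ikq _] pq.
apply/eqP/negP => /negP jk.
have csym : connect_sym (avoiding T i).
  apply: sym_connect_sym => x y /=.
  by rewrite /avoiding /= undirected_sym [(x != i) && _]andbC.
have : connect (avoiding T i) j k.
  apply: connect_trans (avoiding_connect jp ijp) _.
  by rewrite pq csym; apply: avoiding_connect kq ikq.
case/connectP => c0 jc0 kc0.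
case/shortenP: jc0 kc0 => c jc uc _ kc.
have ic : i \notin j :: c.
  rewrite inE negb_or; have := ijp; rewrite inE negb_or => /andP[-> _] /=.
  elim: c j {uc kc jp ij ijp pq jk} jc => //= y c IH j /andP[/and3P[_ _ yi]].
  by move=> /IH h; rewrite inE negb_or eq_sym yi.
have ucyc : ucycle (undirected T) (i :: j :: c).
  apply/andP; split; last by rewrite cons_uniq ic.
  rewrite /= ij /= rcons_path -kc undirected_sym ik andbT.
  by apply: sub_path jc => x y /= /andP[].
have := acyc _ ucyc.
by case: c {jc uc ic ucyc} kc => //= kj; rewrite kj eqxx in jk.
Qed.

(** An edge i -> j begins the simple path from i to r, so there is at most one,
    and none if i = r.  Conversely, if the simple path from i <> r to r began
    with an edge j -> i taken backwards, that edge would itself begin a simple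
    path from j to r, and the rest of that path would leave i by another first
    step. *)
Lemma arborescence_functional r T : arborescence r T ->
  exists f : 'I_n.+1 -> 'I_n.+1,
    forall i j, ((i, j) \in T) = (i != r) && (j == f i).
Proof.
move=> [ST DT]; have [asym conn acyc] := ST.
have root_out j : (r, j) \notin T.
  apply/negP => /DT[p [_ /= /andP[rp _] lp]].
  by move: rp; rewrite -lp mem_last.
have out_unique i j k : (i, j) \in T -> (i, k) \in T -> j = k.
  move=> /DT[p [ip up lp]] /DT[q [iq uq lq]].
  by apply: first_step_unique ST ip up iq uq _; rewrite lp lq.
have out_exists i : i != r -> exists j, (i, j) \in T.
  move=> ir; case/connectP: (conn i r) => p0 ip0 rp0.
  case/shortenP: ip0 rp0 => p ip up _ rp.
  case: p ip up rp => [|j p] ip up rp; first by rewrite rp eqxx in ir.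
  exists j; apply/negP => /negP nij.
  have /DT[q [jq uq lq]] : (j, i) \in T.
    by move: ip => /= /andP[]; rewrite /undirected /= (negPf nij).
  case: q jq uq lq => [|k q] jq uq lq; first by rewrite -lq eqxx in ir.
  suff jk : j = k by move: uq; rewrite jk /= !inE eqxx orbT.
  move: jq uq => /= /andP[_ iq] /andP[_ uq].
  exact: first_step_unique ST ip up iq uq (etrans (esym rp) (esym lq)).
have [f fP] : exists f : 'I_n.+1 -> 'I_n.+1, forall i, i != r -> (i, f i) \in T.
  have H i : exists j, i != r -> (i, j) \in T.
    by case: (eqVneq i r) => [_|/out_exists[j]]; [exists i|exists j].
  by have [f fP] := choice H; exists f.
exists f => i j; apply/idP/andP => [ij|[ir /eqP->]]; last exact: fP.
have ir : i != r by apply/eqP => ir; move: ij; rewrite ir (negPf (root_out _)).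
by split=> //; apply/eqP/(out_unique i) => //; apply: fP.
Qed.

Definition successor_graph r (f : 'I_n.+1 -> 'I_n.+1) :
    {set 'I_n.+1 * 'I_n.+1} :=
  [set (i, f i) | i : 'I_n.+1 & i != r]%SET.

Lemma mem_successor_graph r f i j :
  ((i, j) \in successor_graph r f) = (i != r) && (j == f i).
Proof.
apply/imsetP/andP => [[k]|[ir /eqP->]]; first by rewrite inE => kr [-> ->].
by exists i => //; rewrite inE.
Qed.

Lemma arborescence_successor_graph r T : arborescence r T ->
  exists f, T = successor_graph r f.
Proof.
move=> /arborescence_functional[f fP]; exists f.
by apply/setP => -[i j]; rewrite fP mem_successor_graph.
Qed.

(** The potential d decreases along the edges: following f from any vertex
    reaches r, and no cycle can exist because of its highest vertex. *)
Lemma successor_graph_arborescence r f (d : 'I_n.+1 -> nat) :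
  (forall i, i != r -> (d (f i) < d i)%N) ->
  arborescence r (successor_graph r f).
Proof.
move=> df; set T := successor_graph r f.
have edgeP i j : undirected T i j = (i != r) && (j == f i) || (j != r) && (i == f j).
  by rewrite /undirected /= !mem_successor_graph.
have to_root m i : (d i <= m)%N -> exists p : seq 'I_n.+1,
    [/\ path (undirected T) i p, uniq (i :: p), last i p = r,
        all (fun x => d x < d i)%N p & i != r -> exists q, p = f i :: q].
  elim: m i => [|m IH] i dm.
    have ir : i = r.
      by apply/eqP/negP => /negP /df; move: dm; rewrite leqn0 => /eqP->.
    by exists [::]; split=> //; rewrite ir eqxx.
  have [->|ir] := eqVneq i r; first by exists [::]; split=> //; rewrite eqxx.
  have di := df _ ir.
  have [|p [ip up lp dp _]] := IH (f i); first by rewrite -ltnS (leq_trans di).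
  have dp' : all (fun x => d x < d i)%N p.
    by apply: sub_all dp => x /= /ltn_trans; apply.
  exists (f i :: p); split=> //=.
  - by rewrite edgeP ir eqxx.
  - have -> /= : i \notin f i :: p.
      rewrite inE; apply/negP => /orP[/eqP e|ip'].
        by move: di; rewrite -e ltnn.
      by have /= := allP dp' _ ip'; rewrite ltnn.
    exact: up.
  - by rewrite di.
  - by move=> _; exists p.
have conn i : connect (undirected T) i r.
  have [p [ip _ lp _ _]] := to_root _ i (leqnn _).
  by apply/connectP; exists p.
split; first split.
- move=> i j; rewrite !mem_successor_graph => /andP[/df di /eqP ->].
  apply/negP => /andP[/df dj /eqP e].
  by move: dj; rewrite -e => dj; have := ltn_trans di dj; rewrite ltnn.
- move=> i j; apply: connect_trans (conn i) _.
  by rewrite (sym_connect_sym (undirected_sym T)) conn.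
- move=> c /andP[cyc uc]; rewrite leqNgt; apply/negP => c3.
  have c0 : (0 < size c)%N by apply: leq_trans c3.
  have [x xc xmax] : exists2 x, x \in c & forall y, y \in c -> (d y <= d x)%N.
    case: c c0 {cyc uc c3} => // a c _.
    have [x xc xm] := @arg_maxnP _ a (mem (a :: c)) d (mem_head _ _).
    by exists x.
  (* A vertex of a cycle at which d is maximal has f of it as its only
     possible neighbour, whereas a cycle of size 3 provides two of them. *)
  have nb y : y \in c -> undirected T x y -> y = f x.
    move=> yc; rewrite edgeP => /orP[/andP[_ /eqP//]|/andP[yr /eqP e]].
    by have := df _ yr; rewrite -e ltnNge xmax.
  have [i c' def_c] := rot_to xc.
  have cyc' : cycle (undirected T) (x :: c') by rewrite -def_c rot_cycle.
  have uc' : uniq (x :: c') by rewrite -def_c rot_uniq.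
  have sc' : size (x :: c') = size c by rewrite -def_c size_rot.
  have mc' : x :: c' =i c by move=> y; rewrite -def_c mem_rot.
  case: c' {def_c} cyc' uc' sc' mc' => [|y c'] /= cyc' uc' sc' mc'.
    by rewrite -sc' in c3.
  case/lastP: c' cyc' uc' sc' mc' => [|c' z] cyc' uc' sc' mc'.
    by rewrite -sc' in c3.
  move: cyc' => /andP[xy]; rewrite rcons_path last_rcons => /andP[_ zx].
  have ey : y = f x by apply: nb xy; rewrite -mc' !inE eqxx orbT.
  have ez : z = f x.
    by apply: nb; rewrite 1?undirected_sym// -mc' !inE mem_rcons inE eqxx !orbT.
  by move: uc'; rewrite ey ez !(mem_rcons, inE, negb_or) eqxx /= andbF.
- move=> i j; rewrite mem_successor_graph => /andP[ir /eqP->].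
  have [p [ip up lp _ /(_ ir)[q pq]]] := to_root _ i (leqnn _).
  by exists q; rewrite -pq; split=> //; rewrite -lp pq.
Qed.

End Trees.

(** * Positivity of powers of the transition matrix *)

Section Semigroup.
Local Open Scope nat_scope.

(** The least positive difference d of two elements a and a + d divides every
    element, for otherwise the remainder would be a smaller difference.  Thus
    d = 1, and the consecutive elements a and a + 1 generate all numbers from
    a * a on. *)
Lemma semigroup_eventually (S : nat -> Prop) :
  (forall a, S a -> 0 < a) ->
  (forall a b, S a -> S b -> S (a + b)) ->
  (forall q, (forall a, S a -> q %| a) -> q = 1) ->
  exists M, forall m, M <= m -> S m.
Proof.
move=> Spos Sadd Sgcd.
have [a0 Sa0] : exists a, S a.
  apply/not_existsP => noS.
  by have := Sgcd 2 (fun a Sa => False_ind _ (noS a Sa)).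
have Smul k a : 0 < k -> S a -> S (k * a).
  case: k => // k _ Sa; elim: k => [|k IH]; first by rewrite mul1n.
  by rewrite mulSn; apply: Sadd.
pose D d := `[< 0 < d /\ exists2 a, S a & S (a + d) >].
have exD : exists d, D d.
  exists a0; apply/asboolP; split; first exact: Spos.
  by exists a0 => //; apply: Sadd.
case: (ex_minnP exD) => d /asboolP[d0 [a Sa Sad]] dmin.
have ddvd m : S m -> d %| m.
  move=> Sm; rewrite /dvdn; apply/negP => /negP; rewrite -lt0n => r0.
  have : D (m %% d).
    apply/asboolP; split => //.
    (* This element and m + (m %/ d + 1) * a have difference m %% d. *)
    exists ((m %/ d) * (a + d) + a).
      have [->|q0] := posnP (m %/ d); first by rewrite mul0n.
      by apply: Sadd => //; apply: Smul.
    have -> : (m %/ d) * (a + d) + a + m %% d = m + (m %/ d).+1 * a.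
      by rewrite {3}(divn_eq m d); lia.
    by apply: Sadd => //; apply: Smul.
  by move/dmin; rewrite leqNgt ltn_mod d0.
have d1 := Sgcd d ddvd; rewrite d1 addn1 in Sad.
have apos := Spos _ Sa.
exists (a * a) => m am.
have -> : m = (m %/ a - m %% a) * a + (m %% a) * a.+1.
  have : m %% a < m %/ a.
    by apply: leq_trans (ltn_pmod _ apos) _; rewrite leq_divRL.
  by rewrite {1}(divn_eq m a); nia.
have qpos : 0 < m %/ a - m %% a.
  by rewrite subn_gt0; apply: leq_trans (ltn_pmod _ apos) _; rewrite leq_divRL.
have [r0|r0] := posnP (m %% a); last by apply: Sadd; apply: Smul.
by move: qpos; rewrite r0 mul0n addn0 => qpos; apply: Smul.
Qed.

End Semigroup.

Section Positivity.
Variables (R : realType) (n : nat) (P : 'M[R]_n.+1).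
Hypotheses (tP : transition_matrix P) (iP : irreducible P).

Lemma transition_ge0 i j : 0 <= P i j. Proof. exact: tP.1. Qed.

Lemma power_ge0 m i j : 0 <= (P ^+ m) i j.
Proof.
elim: m i j => [|m IH] i j; first by rewrite expr0 mxE; case: eqP.
by rewrite exprS mxE sumr_ge0 // => k _; rewrite mulr_ge0 ?transition_ge0.
Qed.

Lemma power_gt0_trans a b i j k :
  0 < (P ^+ a) i j -> 0 < (P ^+ b) j k -> 0 < (P ^+ (a + b)) i k.
Proof.
move=> ij jk; rewrite exprD mxE (bigD1 j) //= ltr_wpDr ?mulr_gt0//.
by rewrite sumr_ge0 // => l _; rewrite mulr_ge0 ?power_ge0.
Qed.

Lemma power_gt0_step m i j : 0 < (P ^+ m.+1) i j ->
  exists2 k, 0 < P i k & 0 < (P ^+ m) k j.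
Proof.
rewrite exprS mxE => /lt0r_neq0/eqP h.
apply: contra_notP h => h; apply: big1 => k _; apply/eqP.
rewrite mulf_eq0 -[_ == 0]negbK -[X in _ || X]negbK -negb_and; apply/negP.
move=> /andP[Pik Pkj]; apply: h; exists k.
  by rewrite lt0r Pik transition_ge0.
by rewrite lt0r Pkj power_ge0.
Qed.

Let edge : rel 'I_n.+1 := [rel i j | 0 < P i j].

Lemma power_gt0_connect m i j : 0 < (P ^+ m) i j -> connect edge i j.
Proof.
elim: m i => [|m IH] i.
  by rewrite expr0 mxE; case: eqP => [->|_]; rewrite ?connect0 // ltxx.
by case/power_gt0_step => k ik /IH; apply: connect_trans; apply: connect1.
Qed.

(** A walk without repeated vertices makes at most n steps. *)
Lemma power_gt0_short i j : exists2 m : nat, (m <= n)%N & 0 < (P ^+ m) i j.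
Proof.
have [m /power_gt0_connect/connectP[p0 ip0 jp0]] := iP i j.
case/shortenP: ip0 jp0 => p ip up _ jp; exists (size p).
  by have := max_card (mem (i :: p)); rewrite (card_uniqP up) card_ord.
rewrite jp; elim: p i ip {up jp} => [|k p IH] i /=.
  by rewrite expr0 mxE eqxx.
by case/andP => ik /IH; apply: (@power_gt0_trans 1); rewrite expr1.
Qed.

Lemma row_positive i : exists j, 0 < P i j.
Proof.
apply/not_existsP => h; have := tP.2 i; rewrite big1 => [|j _].
  by move/eqP; rewrite eq_sym oner_eq0.
by apply/eqP; rewrite eq_le transition_ge0 andbT leNgt; apply/negP/h.
Qed.

(** This is why times chosen in 1, ..., N are enough for every state to be
    observed; the first step is taken separately so that the number of steps is
    positive. *)
Lemma power_gt0_reach i j : exists u : 'I_n.+1, 0 < (P ^+ u.+1) i j.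
Proof.
have [k ik] := row_positive i; have [m mn kj] := power_gt0_short k j.
exists (Ordinal (mn : (m < n.+1)%N)).
by apply: (@power_gt0_trans 1 _ _ k) kj; rewrite expr1.
Qed.

(** Let every state point to a state that is closer to r, the distance being
    the least number of steps of a possible walk to r. *)
Lemma trees_nonempty : exists T, T \in trees P.
Proof.
pose r : 'I_n.+1 := ord0.
pose d i := ex_minn (iP i r).
have dP i : 0 < (P ^+ d i) i r by rewrite /d; case: ex_minnP.
have dmin i m : 0 < (P ^+ m) i r -> (d i <= m)%N.
  by rewrite /d; case: ex_minnP => ? _; apply.
have step i : exists k, i != r -> 0 < P i k /\ (d k < d i)%N.
  have [->|ir] := eqVneq i r; first by exists r.
  have := dP i; case E : (d i) => [|m].
    by rewrite expr0 mxE (negPf ir) ltxx.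
  by case/power_gt0_step => k ik /dmin km; exists k.
have [f fP] := choice step.
exists (successor_graph r f); rewrite inE; apply/andP; split.
  apply/asboolP; exists r; apply: (@successor_graph_arborescence _ _ _ d).
  by move=> i /fP[].
apply: prodr_gt0 => -[i j]; rewrite mem_successor_graph.
by move=> /andP[/fP[? _] /eqP->].
Qed.

Lemma total_weight_gt0 : 0 < total_weight P.
Proof.
have [T TP] := trees_nonempty.
rewrite /total_weight (bigD1 T) //= ltr_wpDr //.
  rewrite sumr_ge0 // => S _; rewrite prodr_ge0 // => e _; exact: transition_ge0.
by move: TP; rewrite inE => /andP[].
Qed.

(** The possible return times to j form an additive semigroup with greatest
    common divisor 1; a return to j may be preceded by a walk of at most n steps
    from any other state. *)
Lemma power_eventually_gt0 j : aperiodic P ->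
  exists M, forall m i, (M <= m)%N -> 0 < (P ^+ m) i j.
Proof.
move=> aP.
have [M HM] : exists M, forall m, (M <= m)%N -> (0 < m)%N /\ 0 < (P ^+ m) j j.
  apply: semigroup_eventually => [a []//|a b [a0 ja] [b0 jb]|q h].
    by rewrite addn_gt0 a0; split => //; apply: power_gt0_trans ja jb.
  by apply: (aP j) => m m0 jm; apply: h.
exists (n + M)%N => m i Mm.
have [h hn ih] := power_gt0_short i j.
rewrite -(subnKC (_ : h <= m)%N); last by lia.
by apply: power_gt0_trans ih _; have [] := HM (m - h)%N; first lia.
Qed.

End Positivity.

(** * Finite probability computations *)

Section RealProbability.
Context {R : realType} {d : measure_display} {Om : measurableType d}.
Variable Pr : probability Om R.
Implicit Types A B : set Om.

Definition pr A : R := fine (Pr A).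

Lemma prE A : measurable A -> Pr A = (pr A)%:E.
Proof. by move=> mA; rewrite fineK ?fin_num_measure. Qed.

Lemma cond_probE A B : cond_prob Pr A B = pr (A `&` B) / pr B.
Proof. by []. Qed.

Lemma pr0 : pr set0 = 0.
Proof. by rewrite /pr measure0. Qed.

Lemma prT : pr setT = 1.
Proof. by rewrite /pr probability_setT. Qed.

Lemma pr_ge0 A : 0 <= pr A.
Proof. by rewrite fine_ge0. Qed.

Lemma le_pr A B : measurable A -> measurable B -> A `<=` B -> pr A <= pr B.
Proof.
by move=> mA mB AB; rewrite -lee_fin -!prE// le_measure ?inE.
Qed.

Lemma pr_le1 A : measurable A -> pr A <= 1.
Proof. by move=> mA; rewrite -lee_fin -prE// probability_le1. Qed.

Lemma measurable_forall (I : finType) (F : I -> set Om) :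
  (forall i, measurable (F i)) -> measurable [set om | forall i, F i om].
Proof.
move=> mF.
rewrite (_ : mkset _ = \bigcap_(i in [set: I]) F i).
  by apply: fin_bigcap_measurable.
by apply/seteqP; split => [om h i _|om h i]; apply: h.
Qed.

Lemma pr_partition (F : finType) (g : Om -> F) A :
  measurable A -> (forall y, measurable [set om | g om = y]) ->
  pr A = \sum_y pr (A `&` [set om | g om = y]).
Proof.
move=> mA mg; apply: EFin_inj; rewrite -prE// -sumEFin.
rewrite (eq_bigr _ (fun y _ => esym (prE (measurableI _ _ mA (mg y))))).
rewrite (fsbig_seq _ _ (index_enum_uniq F)).
rewrite -measure_fin_bigcup.
- congr (Pr _); apply/seteqP; split => [om Aom|om [y _ []//]].
  by exists (g om) => //=; rewrite mem_index_enum.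
- exact: finite_finset.
- by move=> y z _ _ [om [[_ <-] [_ <-]]].
- by move=> y _; exact: measurableI.
Qed.

End RealProbability.

Section Cylinders.
Variables (R : realType) (n : nat) (P : 'M[R]_n.+1).
Variables (d : measure_display) (Om : measurableType d) (Pr : probability Om R).
Variables (X : 'I_n.+1 -> nat -> Om -> 'I_n.+1).
Variables (U : nat -> 'I_n.+2 -> Om -> 'I_n.+1).
Hypothesis tP : transition_matrix P.
Hypothesis mX : forall l t i, measurable [set om | X l t om = i].
Hypothesis mU : forall m j i, measurable [set om | U m j om = i].
Hypothesis markovX : forall l, markov_chain Pr P X l.
Hypothesis indX : cond_independent_chains Pr X.
Hypothesis unifU : uniform_numbers Pr U.
Hypothesis indU : independent_numbers Pr X U.

Local Notation state := 'I_n.+1.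
Local Notation pr := (pr Pr).
Implicit Types (m : nat) (s : state -> nat) (H : set Om).

(** The time horizon s l depends on the chain l, because the chains are later
    observed at different times. *)
Definition cylinder m s (x : state -> nat -> state)
    (u : nat -> 'I_n.+2 -> state) : set Om :=
  [set om | (forall l a, (a <= s l)%N -> X l a om = x l a) /\
            (forall k j, (k < m)%N -> U k j om = u k j)].

Definition cylinder_weight m s (x : state -> nat -> state) : R :=
  (n.+1%:R^-1) ^+ (m * n.+2) * pr (starts_at X [ffun l => x l 0%N]) *
  \prod_l \prod_(a < s l) P (x l a) (x l a.+1).

Lemma measurable_starts_at v : measurable (starts_at X v).
Proof.
by apply: (measurable_forall (F := fun l => [set om | X l 0%N om = v l])).
Qed.

Lemma measurable_follows l t (y : nat -> state) :
  measurable (follows X l t y).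
Proof.
rewrite (_ : follows _ _ _ _ =
    [set om | forall a : 'I_t.+1, [set om | X l a om = y a] om]).
  by apply: (measurable_forall (F := fun a : 'I_t.+1 => [set om | X l a om = y a])).
apply/seteqP; split => om h a; first by apply: h; rewrite -ltnS.
by rewrite -ltnS => at1; apply: (h (Ordinal at1)).
Qed.

Lemma measurable_cylinder m s x u : measurable (cylinder m s x u).
Proof.
rewrite (_ : cylinder _ _ _ _ =
    [set om | forall l, follows X l (s l) (x l) om] `&`
    [set om | forall p : 'I_m * 'I_n.+2, [set om | U p.1 p.2 om = u p.1 p.2] om]).
  apply: measurableI.
    apply: (measurable_forall (F := fun l => follows X l (s l) (x l))) => l.
    exact: measurable_follows.
  by apply: (measurable_forall (F := fun p : 'I_m * 'I_n.+2 =>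
    [set om | U p.1 p.2 om = u p.1 p.2])).
apply/seteqP; split => om [h1 h2]; split.
- by move=> l a; apply: h1.
- by move=> [k j]; apply: h2.
- by move=> l a; apply: h1.
- by move=> k j km; apply: (h2 (Ordinal km, j)).
Qed.

Lemma pr_follows l t (v : {ffun state -> state}) (y : nat -> state) : y 0%N = v l ->
  pr (starts_at X v `&` follows X l t y) =
  pr (starts_at X v) * \prod_(a < t) P (y a) (y a.+1).
Proof.
move=> yv; elim: t => [|t IH].
  rewrite big_ord0 mulr1; congr pr; apply/seteqP; split => [om []//|om h].
  by split=> // a; rewrite leqn0 => /eqP ->; rewrite h.
set B := starts_at X v `&` follows X l t y in IH *.
have mB : measurable B.
  by apply: measurableI; [apply: measurable_starts_at|apply: measurable_follows].
have -> : starts_at X v `&` follows X l t.+1 y =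
    [set om | X l t.+1 om = y t.+1] `&` B.
  apply/seteqP; split => om.
    move=> [h1 h2]; split; first exact: h2.
    by split=> // a at1; apply: h2; apply: leqW.
  move=> [h1 [h2 h3]]; split=> // a; rewrite leq_eqVlt => /orP[/eqP->//|].
  exact: h3.
rewrite big_ord_recr /= mulrA -IH.
have [B0|B0] := eqVneq (pr B) 0.
  rewrite B0 mul0r; apply/eqP; rewrite eq_le pr_ge0 andbT -B0.
  by apply: le_pr => //; [exact: measurableI].
have hB : Pr B != 0%E by rewrite prE// eqe.
have := markovX (y t.+1) hB; rewrite cond_probE => <-.
by rewrite mulrC divfK.
Qed.

Lemma pr_paths t x :
  pr (\bigcap_l follows X l t (x l)) =
  pr (starts_at X [ffun l => x l 0%N]) *
  \prod_l \prod_(a < t) P (x l a) (x l a.+1).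
Proof.
set v := finfun _; set A := \bigcap_l _; have ms := measurable_starts_at v.
have mA : measurable A.
  by apply: fin_bigcap_measurable => // l _; apply: measurable_follows.
have sA : A `<=` starts_at X v by move=> om h l; rewrite ffunE; apply: h.
have [v0|v0] := eqVneq (pr (starts_at X v)) 0.
  rewrite v0 mul0r; apply/eqP; rewrite eq_le pr_ge0 andbT -v0.
  exact: le_pr.
have hv : Pr (starts_at X v) != 0%E by rewrite prE// eqe.
have := indX hv t x; rewrite cond_probE (setIidl sA) => /(canRL (divfK v0)) ->.
rewrite mulrC; congr (_ * _); apply: eq_bigr => l _.
by rewrite cond_probE setIC pr_follows ?ffunE// mulrC mulKf.
Qed.

(** With a common horizon, this is the factorisation into random numbers,
    initial states and transitions that the hypotheses assert. *)
Lemma pr_cylinder_const m t x u :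
  pr (cylinder m (fun=> t) x u) = cylinder_weight m (fun=> t) x.
Proof.
pose r := [seq (k, j) | k <- iota 0 m, j <- enum 'I_n.+2].
have ur : uniq r.
  by apply: allpairs_uniq; rewrite ?iota_uniq ?enum_uniq// => -[? ?] [? ?].
have sr : size r = (m * n.+2)%N.
  by rewrite size_allpairs size_iota -cardE card_ord.
rewrite /cylinder_weight -mulrA -pr_paths.
have mA : measurable (\bigcap_l follows X l t (x l)).
  by apply: fin_bigcap_measurable => // l _; apply: measurable_follows.
have -> : cylinder m (fun=> t) x u =
    [set om | forall p, p \in r -> U p.1 p.2 om = u p.1 p.2] `&`
    \bigcap_l follows X l t (x l).
  apply/seteqP; split => om [h1 h2]; split.
  - move=> [k j] /allpairsP[[k' j'] /= [kr _ [-> ->]]].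
    by apply: h2; rewrite mem_iota add0n in kr.
  - by move=> l _ a; apply: h1.
  - by move=> l a; apply: h2.
  - move=> k j km; apply: (h1 (k, j)); apply/allpairsP; exists (k, j).
    by rewrite mem_iota mem_enum.
have := indU (fun p => u p.1 p.2) t x ur; rewrite [X in (_ * X)%E]prE// => h.
apply: EFin_inj; rewrite -prE; last first.
  apply: measurableI => //.
  rewrite (_ : mkset _ = \bigcap_(p in [set` r])
     [set om | U p.1 p.2 om = u p.1 p.2]) //.
  by apply: fin_bigcap_measurable => //; exact: finite_seq.
rewrite h EFinM; congr (_ * _)%E.
under eq_bigr do rewrite unifU.
by rewrite -sr; elim: r {ur sr h} => [|p r IH] /=;
   rewrite ?big_nil// big_cons IH exprS EFinM.
Qed.

Definition path_update (x : state -> nat -> state) l a j : state -> nat -> state :=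
  fun l' a' => if (l' == l) && (a' == a) then j else x l' a'.

Lemma cylinder_step m s x u l j :
  cylinder m s x u `&` [set om | X l (s l).+1 om = j] =
  cylinder m [eta s with l |-> (s l).+1] (path_update x l (s l).+1 j) u.
Proof.
rewrite /path_update; apply/seteqP; split => om.
  move=> [[h1 h2] h3]; split=> // l' a /=.
  have [->|ll] := eqVneq l' l => /= al; last exact: h1.
  have [->//|asl] := eqVneq a (s l).+1.
  by apply: h1; rewrite -ltnS ltn_neqAle asl.
move=> [h1 h2]; split; last by have := h1 l (s l).+1; rewrite /= !eqxx; apply.
split=> // l' a al; have := h1 l' a => /=.
case: (eqVneq l' l) al => [->|ll] /= al; last exact.
rewrite (ltn_eqF (_ : a < (s l).+1)%N) //; apply; exact: leqW.
Qed.

Lemma cylinder_weight_step m s x l j :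
  cylinder_weight m [eta s with l |-> (s l).+1] (path_update x l (s l).+1 j) =
  cylinder_weight m s x * P (x l (s l)) j.
Proof.
rewrite /cylinder_weight -!mulrA; congr (_ * _); congr (_ * _).
  by congr (pr (starts_at _ _)); apply/ffunP => l'; rewrite !ffunE /path_update andbF.
rewrite (bigD1 l) //= [in RHS](bigD1 l) //= !eqxx [in RHS]mulrAC.
rewrite big_ord_recr /=; congr (_ * _ * _).
- apply: eq_bigr => a _; rewrite /path_update eqxx /= !eqSS.
  by rewrite (ltn_eqF (_ : a < (s l).+1)%N) ?(ltn_eqF (ltn_ord a))// leqW.
- by rewrite /path_update !eqxx /= (ltn_eqF (leqnn _)).
- apply: eq_bigr => l' /negPf ll; rewrite ll.
  by apply: eq_bigr => a _; rewrite /path_update ll.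
Qed.

(** Horizons that differ are reached from a common one by shortening them one
    step at a time: forgetting the last state of chain l amounts to a sum over a
    row of P, which is 1. *)
Lemma pr_cylinder m s x u : pr (cylinder m s x u) = cylinder_weight m s x.
Proof.
have [t st] : exists t, forall l, (s l <= t)%N.
  by exists (\max_l s l) => l; apply: leq_bigmax.
have [k] := ubnP (\sum_l (t - s l))%N.
elim: k s x st => // k IH s x st sk.
have [/forallP s_t|] := boolP [forall l, s l == t].
  have -> : s = fun=> t by apply/funext => l; apply/eqP.
  exact: pr_cylinder_const.
rewrite negb_forall => /existsP[l sl].
have slt : (s l < t)%N by rewrite ltn_neqAle sl st.
rewrite (@pr_partition _ _ _ _ _ (X l (s l).+1)) //; last exact: measurable_cylinder.
under eq_bigr => j _.
  rewrite cylinder_step IH; last 2 first.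
  - by move=> l' /=; case: eqP.
  - rewrite -ltnS; apply: leq_trans sk; rewrite ltnS.
    rewrite (bigD1 l) // [in X in (_ < X)%N](bigD1 l) //= eqxx -addSn.
    apply: leq_add; first by rewrite subnSK.
    by apply: leq_sum => l' /negPf ->.
  rewrite cylinder_weight_step.
  over.
by rewrite -mulr_sumr tP.2 mulr1.
Qed.
(** The atom containing om of the information given by the random numbers of the
    first m rounds and by each chain l up to the time s l. *)
Definition past m s (om : Om) : set Om :=
  cylinder m s (fun l a => X l a om) (fun k j => U k j om).

Definition determined m s (H : set Om) : Prop :=
  forall om, H om -> past m s om `<=` H.

Lemma past_sym m s om om' : past m s om om' -> past m s om' om.
Proof.
move=> [h1 h2]; split; first by move=> l a al; rewrite h1.
by move=> k j km; rewrite h2.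
Qed.

Lemma past_finite m s : exists (F : finType) (g : Om -> F),
  (forall y, measurable [set om | g om = y]) /\
  forall om, [set om' | g om' = g om] = past m s om.
Proof.
pose t := \max_l s l.
pose F : finType :=
  ({ffun state * 'I_t.+1 -> state} * {ffun 'I_m * 'I_n.+2 -> state})%type.
pose g om : F := ([ffun p : state * 'I_t.+1 =>
                     if (p.2 <= s p.1)%N then X p.1 p.2 om else ord0],
                  [ffun p : 'I_m * 'I_n.+2 => U p.1 p.2 om]).
have gE om : [set om' | g om' = g om] = past m s om.
  apply/seteqP; split => om'.
    move=> [/ffunP h1 /ffunP h2]; split.
      move=> l a al.
      have lt : (a < t.+1)%N by rewrite ltnS (leq_trans al)// leq_bigmax.
      by have := h1 (l, Ordinal lt); rewrite !ffunE /= al.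
    by move=> k j km; have := h2 (Ordinal km, j); rewrite !ffunE.
  move=> [h1 h2]; congr pair; apply/ffunP => -[l a]; rewrite !ffunE /=.
    by case: ifP => // /h1.
  by rewrite h2.
exists F, g; split=> // y.
have [[om gy]|nog] := pselect (exists om, g om = y).
  by rewrite -gy gE; apply: measurable_cylinder.
rewrite (_ : mkset _ = set0); first exact: measurable0.
by apply/seteqP; split => // om gy; apply: nog; exists om.
Qed.

Lemma measurable_determined m s H : determined m s H -> measurable H.
Proof.
move=> dH; have [F [g [mg gE]]] := past_finite m s.
rewrite (_ : H = \bigcup_(y in g @` H) [set om | g om = y]).
  by apply: fin_bigcup_measurable => //; exact: finite_finset.
apply/seteqP; split => [om Hom|om [_ [om' Hom' <-]] /= e].
  by exists (g om) => //; exists om.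
by apply: dH Hom' _ _; rewrite -gE.
Qed.

(** A determined event is a finite disjoint union of atoms, so an identity that
    is linear in the event needs to be known on atoms only, where [pr_cylinder]
    gives explicit products. *)
Lemma determined_scale m s H (Q : set Om) c :
  determined m s H -> measurable Q ->
  (forall om, H om -> pr (past m s om `&` Q) = c * pr (past m s om)) ->
  pr (H `&` Q) = c * pr H.
Proof.
move=> dH mQ hQ; have [F [g [mg gE]]] := past_finite m s.
have mH := measurable_determined dH.
rewrite (pr_partition _ (measurableI _ _ mH mQ) mg) (pr_partition _ mH mg).
rewrite mulr_sumr; apply: eq_bigr => y _.
have [[om [Hom gy]]|nog] := pselect (exists om, H om /\ g om = y).
  have E : H `&` [set om' | g om' = y] = past m s om.
    rewrite -gy gE; apply/seteqP; split => [? []//|om' p].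
    by split=> //; apply: dH Hom _ p.
  by rewrite setIAC E hQ.
have E : H `&` [set om' | g om' = y] = set0.
  by apply/seteqP; split => // om [Hom gy]; apply: nog; exists om.
by rewrite setIAC E set0I pr0 mulr0.
Qed.

Lemma past_sub m m' s s' om : (m <= m')%N -> (forall l, (s l <= s' l)%N) ->
  past m' s' om `<=` past m s om.
Proof.
move=> mm ss om' [h1 h2]; split=> [l a al|k j km].
  by apply: h1; apply: leq_trans al _.
by apply: h2; apply: leq_trans km _.
Qed.

Lemma determined_mono m m' s s' H :
  (m <= m')%N -> (forall l, (s l <= s' l)%N) ->
  determined m s H -> determined m' s' H.
Proof.
by move=> mm ss dH om Hom om' /(past_sub mm ss); apply: dH.
Qed.

Lemma determinedI m s H H' :
  determined m s H -> determined m s H' -> determined m s (H `&` H').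
Proof. by move=> dH dH' om [h h'] om' p; split; [apply: dH p|apply: dH' p]. Qed.

Lemma determined_state m s l t i :
  (t <= s l)%N -> determined m s [set om | X l t om = i].
Proof. by move=> tl om <- om' [h _] /=; rewrite h. Qed.

(** The Markov property of one chain relative to what is known of all the
    chains, each up to its own horizon. *)
Lemma markov_step m s H l i j :
  determined m s H -> H `<=` [set om | X l (s l) om = i] ->
  pr (H `&` [set om | X l (s l).+1 om = j]) = P i j * pr H.
Proof.
move=> dH Hi; apply: (determined_scale dH) => // om Hom.
by rewrite /past cylinder_step !pr_cylinder cylinder_weight_step (Hi _ Hom) mulrC.
Qed.

Lemma markov_steps m s H l i j k :
  determined m s H -> H `<=` [set om | X l (s l) om = i] ->
  pr (H `&` [set om | X l (s l + k)%N om = j]) = (P ^+ k) i j * pr H.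
Proof.
move=> dH Hi; elim: k j => [|k IH] j.
  rewrite addn0 expr0 mxE; case: eqP => [<-|ij].
    by rewrite (setIidl Hi) mul1r.
  rewrite mul0r (_ : _ `&` _ = set0) ?pr0//.
  by apply/seteqP; split => // om [/Hi /= -> /ij].
have mH := measurable_determined dH.
rewrite (@pr_partition _ _ _ _ _ (X l (s l + k)%N)) //; last exact: measurableI.
rewrite exprSr mxE mulr_suml; apply: eq_bigr => y _.
rewrite setIAC mulrAC -IH mulrC.
set s' := [eta s with l |-> (s l + k)%N].
have e : s' l = (s l + k)%N by rewrite /= eqxx.
have /markov_step : determined m s' (H `&` [set om | X l (s l + k)%N om = y]).
  apply: determinedI; last by apply: determined_state; rewrite e.
  apply: determined_mono dH => // l' /=.
  by case: eqP => [->|_] //; apply: leq_addr.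
by move=> /(_ l y j); rewrite e addnS; apply; apply: subIsetr.
Qed.

Lemma markov_two_times m s H l i a i1 b i2 :
  determined m s H -> H `<=` [set om | X l (s l) om = i] ->
  pr (H `&` [set om | X l (s l + a)%N om = i1 /\ X l (s l + a + b)%N om = i2]) =
  (P ^+ a) i i1 * (P ^+ b) i1 i2 * pr H.
Proof.
move=> dH Hi.
have -> : [set om | X l (s l + a)%N om = i1 /\ X l (s l + a + b)%N om = i2] =
    [set om | X l (s l + a)%N om = i1] `&` [set om | X l (s l + a + b)%N om = i2].
  by [].
rewrite setIA -mulrA mulrCA -(markov_steps i1 a dH Hi).
set s' := [eta s with l |-> (s l + a)%N].
have e : s' l = (s l + a)%N by rewrite /= eqxx.
have /markov_steps : determined m s' (H `&` [set om | X l (s l + a)%N om = i1]).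
  apply: determinedI; last by apply: determined_state; rewrite e.
  apply: determined_mono dH => // l' /=.
  by case: eqP => [->|_] //; apply: leq_addr.
by move=> /(_ l i1 i2 b); rewrite e; apply; apply: subIsetr.
Qed.

(** The chains are treated one after the other: looking ahead in one of them
    moves only its own horizon, so that the event remains determined and the
    remaining chains stay where they were. *)
Lemma markov_chains m s H (y : state -> state) (a b : state -> nat)
    (i1 i2 : state -> state) :
  determined m s H -> H `<=` [set om | forall l, X l (s l) om = y l] ->
  pr (H `&` [set om | forall l, X l (s l + a l)%N om = i1 l /\
                                X l (s l + a l + b l)%N om = i2 l]) =
  (\prod_l ((P ^+ a l) (y l) (i1 l) * (P ^+ b l) (i1 l) (i2 l))) * pr H.
Proof.
move=> dH Hy.
have main (ls : seq state) : uniq ls -> forall s' H', determined m s' H' ->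
    (forall l, l \in ls -> s' l = s l) ->
    H' `<=` [set om | forall l, l \in ls -> X l (s l) om = y l] ->
    pr (H' `&` [set om | forall l, l \in ls ->
                  X l (s l + a l)%N om = i1 l /\ X l (s l + a l + b l)%N om = i2 l]) =
    (\prod_(l <- ls) ((P ^+ a l) (y l) (i1 l) * (P ^+ b l) (i1 l) (i2 l))) * pr H'.
  elim: ls => [_ s' H' _ _ _|l ls IH /andP[lls uls] s' H' dH' ss' Hy'].
    rewrite big_nil mul1r; congr pr.
    by apply/seteqP; split => [om []//|om h]; split.
  have sl : s' l = s l by rewrite ss' ?mem_head.
  set Q := [set om | X l (s l + a l)%N om = i1 l /\ X l (s l + a l + b l)%N om = i2 l].
  have HQ : pr (H' `&` Q) =
      (P ^+ a l) (y l) (i1 l) * (P ^+ b l) (i1 l) (i2 l) * pr H'.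
    rewrite /Q -sl; apply: markov_two_times dH' _ => om /Hy' /=.
    by rewrite sl; apply; rewrite mem_head.
  rewrite big_cons -mulrA mulrCA -HQ.
  rewrite -(IH uls [eta s' with l |-> (s l + a l + b l)%N]).
  - congr pr; apply/seteqP; split => om.
      move=> [h1 h2]; split; first by split=> //; apply: h2; rewrite mem_head.
      by move=> l' l'ls; apply: h2; rewrite inE l'ls orbT.
    move=> [[h1 hQ] h2]; split=> // l'; rewrite inE => /orP[/eqP->//|].
    exact: h2.
  - apply: determinedI.
      apply: determined_mono dH' => // l' /=.
      by case: eqP => [->|_] //; rewrite sl -addnA leq_addr.
    by apply: determinedI; apply: determined_state; rewrite /= eqxx // leq_addr.
  - move=> l' l'ls /=; case: eqP => [e|_]; first by rewrite -e l'ls in lls.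
    by rewrite ss' // inE l'ls orbT.
  - by move=> om [/Hy' h _] l' l'ls; apply: h; rewrite inE l'ls orbT.
have := main _ (index_enum_uniq _) s H dH (fun _ _ => erefl).
move=> <-; last by move=> om /Hy h l _.
congr pr; apply/seteqP; split => om [h1 h2]; split => // l.
by apply: h2; rewrite mem_index_enum.
Qed.

Definition round_numbers m (om : Om) : {ffun 'I_n.+2 -> state} :=
  [ffun j => U m j om].

Lemma measurable_round_numbers m u :
  measurable [set om | round_numbers m om = u].
Proof.
rewrite (_ : mkset _ = [set om | forall j, [set om | U m j om = u j] om]).
  by apply: (measurable_forall (F := fun j => [set om | U m j om = u j])).
apply/seteqP; split => om /=; first by move=> <- j; rewrite ffunE.
by move=> h; apply/ffunP => j; rewrite ffunE.
Qed.

Lemma determined_round_numbers m s u :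
  determined m.+1 s [set om | round_numbers m om = u].
Proof.
by move=> om <- om' [_ h]; apply/ffunP => j; rewrite !ffunE h.
Qed.

Lemma pr_round_numbers m s H u :
  determined m s H ->
  pr (H `&` [set om | round_numbers m om = u]) = (n.+1%:R^-1) ^+ n.+2 * pr H.
Proof.
move=> dH; apply: (determined_scale dH).
  exact: measurable_round_numbers.
move=> om Hom.
have -> : past m s om `&` [set om' | round_numbers m om' = u] =
    cylinder m.+1 s (fun l a => X l a om)
      (fun k j => if k == m then u j else U k j om).
  apply/seteqP; split => om'.
    move=> [[h1 h2] h3]; split=> // k j; rewrite ltnS leq_eqVlt.
    by case: eqP => [-> _|_ /h2//]; rewrite -h3 ffunE.
  move=> [h1 h2]; split.
    split=> // k j km; rewrite h2 ?(ltn_eqF km)//; exact: leqW.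
  by apply/ffunP => j; rewrite ffunE h2 ?eqxx.
by rewrite /past !pr_cylinder /cylinder_weight mulSn exprD -!mulrA.
Qed.

Local Notation start := (@round_start n).

Definition observed m (om : Om) : {ffun state -> state} :=
  [ffun l => X l (obs_time U m l om) om].

Lemma past_obs_time m om om' l :
  past m.+1 (fun=> start m.+1) om om' ->
  X l (obs_time U m l om') om' = X l (obs_time U m l om) om.
Proof.
move=> [h1 h2]; have hU j : U m j om' = U m j om by apply: h2.
rewrite /obs_time /num0 /Defs.num !hU; apply: h1; rewrite /round_start.
have := ltn_ord (U m ord0 om); have := ltn_ord (U m (lift ord0 l) om).
by case: ifP => _; nia.
Qed.

Lemma determined_observed m g :
  determined m.+1 (fun=> start m.+1) [set om | observed m om = g].
Proof.
by move=> om <- om' p; apply/ffunP => l; rewrite !ffunE; apply: past_obs_time.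
Qed.

Lemma event_ET_past m T om om' :
  past m.+1 (fun=> start m.+1) om om' ->
  event_ET X U m T om' = event_ET X U m T om.
Proof.
move=> p; have [h1 h2] := p; have hU j : U m j om' = U m j om by apply: h2.
have bound l : ((U m l om).+1 <= n.+1)%N := ltn_ord _.
rewrite /event_ET; congr [&& _, _, _ & _].
- by apply: eq_forallb => l; rewrite h1 // /round_start; nia.
- rewrite /event_B /num0 hU h1 // /round_start; have := bound ord0; nia.
- congr (_ == _); apply: eq_imset => l; exact: past_obs_time.
- congr (_ == _); apply: eq_imset => l; rewrite /Defs.num hU.
  by rewrite !h1 // /round_start; have := bound (lift ord0 l); nia.
Qed.

Lemma determined_event_ET m T :
  determined m.+1 (fun=> start m.+1) [set om | event_ET X U m T om].
Proof. by move=> om hom om' /event_ET_past h; rewrite /= h. Qed.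

(** In the following, T is the arborescence given by f and r, and g l is the
    state in which chain l is observed: the vertex that chain l contributes to
    event C. *)
Section Round.
Variables (m : nat) (r : state) (f : state -> state).
Local Notation T := (successor_graph r f).

(* Chain l is looked at twice, at first_time after the start of the round and
   at second_time later.  For l = 1 these are the return to state 1 of event B
   and the observation of event C; for l > 1 they are the observation and the
   step that follows it. *)
Let first_time (u : {ffun 'I_n.+2 -> state}) (l : state) : nat :=
  if l == ord0 then (u ord0).+1 else (u (lift ord0 l)).+1.
Let second_time (u : {ffun 'I_n.+2 -> state}) (l : state) : nat :=
  if l == ord0 then (u (lift ord0 ord0)).+1 else 1.
Let first_state (g : state -> state) (l : state) : state :=
  if l == ord0 then ord0 else g l.
Let second_state (g : state -> state) (l : state) : state :=
  if l == ord0 then g ord0 else f (g l).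

Definition rooted_labelling (g : {ffun state -> state}) : bool :=
  injectiveb g && (g ord0 == r).

(** Event C says that g is a permutation.  The sources of the edges recorded by
    the chains l > 1 are then all the states but g 1, and those of T are all the
    states but r; hence g 1 = r, and an edge of T is known from its source. *)
Lemma event_ET_observed om (u : {ffun 'I_n.+2 -> state}) g :
  round_numbers m om = u -> event_A X m om ->
  (event_ET X U m T om /\ observed m om = g) <->
  (rooted_labelling g /\ forall l,
     X l (start m + first_time u l)%N om = first_state g l /\
     X l (start m + first_time u l + second_time u l)%N om
       = second_state g l).
Proof.
move=> hu hA; have hU j : U m j om = u j by rewrite -hu ffunE.
rewrite /event_ET hA /=; split.
  move=> [/and3P[/eqP hB /eqP hC /eqP hD] hg].
  have gE l : g l = X l (obs_time U m l om) om by rewrite -hg ffunE.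
  have gT : [set g l | l : state]%SET = [set: state]%SET.
    by rewrite -hC; apply: eq_imset => l; rewrite gE.
  have ginj : injective g.
    have /imset_injP h : #|[set g l | l : state]%SET| == #|state|.
      by rewrite gT cardsT.
    by move=> x y; apply: h.
  have edge l : l != ord0 ->
      g l != r /\ X l (start m + (u (lift ord0 l)).+1).+1 om = f (g l).
    move=> l0.
    have : (X l (start m + Defs.num U m l om) om,
            X l (start m + Defs.num U m l om).+1 om) \in T.
      by rewrite -hD; apply/imsetP; exists l => //; rewrite inE.
    rewrite mem_successor_graph /Defs.num hU => /andP[].
    have -> : X l (start m + (u (lift ord0 l)).+1)%N om = g l.
      by rewrite gE /obs_time (negPf l0) /Defs.num hU.
    by move=> gr /eqP ->.
  have gr : g ord0 = r.
    have : r \in [set g l | l : state]%SET by rewrite gT inE.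
    case/imsetP => l _ rl; have [l0|/edge[]] := eqVneq l ord0.
      by rewrite rl l0.
    by rewrite -rl eqxx.
  split; first by rewrite /rooted_labelling gr eqxx andbT; apply/injectiveP.
  move=> l; rewrite /first_time /second_time /first_state /second_state.
  have [->|l0] := eqVneq l ord0.
    rewrite -hU; split; first exact: hB.
    by rewrite gE /obs_time eqxx /num0 /Defs.num !hU.
  split; first by rewrite gE /obs_time (negPf l0) /Defs.num hU.
  by rewrite addn1; have [_] := edge _ l0.
move=> [/andP[/injectiveP ginj /eqP gr] h].
have gE l : X l (obs_time U m l om) om = g l.
  have := h l; rewrite /first_time /second_time /first_state /second_state.
  rewrite /obs_time /num0 /Defs.num !hU.
  by have [->|l0] := eqVneq l ord0 => -[].
have gsurj (x : state) : exists l, x = g l.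
  by exists (invF ginj x); rewrite f_invF.
split; last by apply/ffunP => l; rewrite ffunE gE.
apply/and3P; split.
- have := h ord0; rewrite /first_time /first_state eqxx => -[h0 _].
  by rewrite /event_B /num0 hU h0.
- apply/eqP/setP => x; rewrite inE; have [l ->] := gsurj x.
  by apply/imsetP; exists l => //; rewrite gE.
- have hl l : l != ord0 ->
     X l (start m + Defs.num U m l om)%N om = g l /\
     X l (start m + Defs.num U m l om).+1 om = f (g l).
    move=> l0; have := h l; rewrite /first_time /second_time /first_state.
    by rewrite /second_state (negPf l0) addn1 /Defs.num hU.
  apply/eqP/setP => -[x y]; rewrite mem_successor_graph.
  apply/imsetP/andP => [[l]|[xr /eqP->]].
    rewrite inE => l0 [-> ->]; have [-> ->] := hl _ l0; split=> //.
    by rewrite -gr (inj_eq ginj).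
  have [l xl] := gsurj x; have l0 : l != ord0.
    by apply: contraNneq xr => e; rewrite xl e gr.
  by exists l; [rewrite inE|have [-> ->] := hl _ l0; rewrite xl].
Qed.

(** N times the probability that a chain started in state 1 is in state i at a
    uniform random time in 1, ..., N. *)
Definition reach i : R := \sum_(k < n.+1) (P ^+ k.+1) ord0 i.

Lemma tree_weight_successor_graph :
  tree_weight P T = \prod_(i | i != r) P i (f i).
Proof.
rewrite /tree_weight big_imset /=; last by move=> i j _ _ [].
by apply: eq_bigl => i; rewrite inE.
Qed.

(** The factor of chain l > 1 is the weight of the edge of T that leaves g l,
    times the probability of reaching g l from state 1 in U_l steps; chain 1 has to
    return to state 1 and then to reach g 1.  Each random number appears in a
    single factor, so the sum over u is a product of sums, and since g is a
    permutation this product does not depend on g. *)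
Lemma sum_round_weights g : rooted_labelling g ->
  \sum_(u : {ffun 'I_n.+2 -> state})
    \prod_l ((P ^+ first_time u l) ord0 (first_state g l) *
             (P ^+ second_time u l) (first_state g l) (second_state g l)) =
  reach ord0 * (\prod_i reach i) * tree_weight P T.
Proof.
move=> /andP[/injectiveP ginj /eqP gr].
have gbij : bijective g by apply: injF_bij.
pose F (j : 'I_n.+2) (k : state) : R :=
  (* The number U_0 governs the return to state 1, the number U_l the way from
     there to g l. *)
  (P ^+ k.+1) ord0 (if unlift ord0 j is Some l then g l else ord0).
have E (u : {ffun 'I_n.+2 -> state}) :
    \prod_l ((P ^+ first_time u l) ord0 (first_state g l) *
             (P ^+ second_time u l) (first_state g l) (second_state g l)) =
    (\prod_j F j (u j)) * tree_weight P T.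
  rewrite [in RHS]big_ord_recl /F unlift_none [in RHS](bigD1 ord0) //=.
  rewrite liftK (bigD1 ord0) //= /first_time /second_time /first_state.
  rewrite /second_state eqxx -!mulrA; congr (_ * (_ * _)).
  rewrite tree_weight_successor_graph.
  rewrite [\prod_(i | i != r) _](reindex g) /=; last exact: onW_bij.
  rewrite [\prod_(i | g i != r) _](eq_bigl (fun l => l != ord0)) => [|l]; last first.
    by rewrite -gr (inj_eq ginj).
  rewrite -big_split /=; apply: eq_bigr => l /negPf l0.
  by rewrite l0 liftK expr1.
rewrite (eq_bigr _ (fun u _ => E u)).
rewrite -mulr_suml -(bigA_distr_bigA F) big_ord_recl /F unlift_none.
congr (_ * _ * _); rewrite [RHS](reindex g) /=; last exact: onW_bij.
by apply: eq_bigr => l _; rewrite liftK.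
Qed.

End Round.

(** Exchanging the values 1 and r is a bijection between the two sets. *)
Lemma card_rooted_labelling r :
  #|[set g | rooted_labelling r g]%SET| = #|[set g | rooted_labelling ord0 g]%SET|.
Proof.
pose phi (g : {ffun state -> state}) : {ffun state -> state} :=
  [ffun l => tperm ord0 r (g l)].
have phiK : involutive phi.
  by move=> g; apply/ffunP => l; rewrite /phi !ffunE tpermK.
rewrite -(on_card_preimset (f := phi) (onW_bij _ (inv_bij phiK))).
apply: eq_card => g; rewrite !inE /rooted_labelling /phi ffunE.
congr (_ && _).
  apply/injectiveP/injectiveP => ginj x y.
    by move=> e; apply: ginj; rewrite !ffunE e.
  by rewrite !ffunE => /perm_inj/ginj.
by rewrite -{2}(tpermL ord0 r) (inj_eq perm_inj).
Qed.

Definition round_const : R :=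
  (n.+1%:R^-1) ^+ n.+2 * (reach ord0 * \prod_i reach i) *
  #|[set g | rooted_labelling ord0 g]%SET|%:R.

Lemma determined_event_A m s : (forall l, start m <= s l)%N ->
  determined 0 s [set om | event_A X m om].
Proof.
move=> ms om hA om' [h _] /=; apply/forallP => l; rewrite h //.
exact: (forallP hA l).
Qed.

(** The constant is independent of T, of the round and of H: this is what makes
    the algorithm both exact and interruptible. *)
Lemma pr_event_ET m r f H : determined m (fun=> start m) H ->
  pr (H `&` [set om | event_ET X U m (successor_graph r f) om]) =
  round_const * tree_weight P (successor_graph r f) *
    pr (H `&` [set om | event_A X m om]).
Proof.
move=> dH; set T := successor_graph r f.
set K := H `&` [set om | event_A X m om].
have dK : determined m (fun=> start m) K.
  apply: determinedI => //.
  by apply: determined_mono (determined_event_A (fun=> leqnn _)).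
have -> : H `&` [set om | event_ET X U m T om] =
          K `&` [set om | event_ET X U m T om].
  apply/seteqP; split => om [h1 h2]; last by case: h1.
  by split=> //; split=> //; case/and4P: h2.
have dE : determined m.+1 (fun=> start m.+1) (K `&` [set om | event_ET X U m T om]).
  apply: determinedI; last exact: determined_event_ET.
  by apply: determined_mono dK => // l; rewrite /round_start; nia.
have mE := measurable_determined dE.
rewrite (pr_partition _ mE (measurable_round_numbers m)).
have mg g := measurable_determined (@determined_observed m g).
under eq_bigr => u _.
  rewrite (pr_partition _ (measurableI _ _ mE (measurable_round_numbers m u)) mg).
  over.
rewrite exchange_big /=.
have E g : \sum_u pr (K `&` [set om | event_ET X U m T om] `&`
       [set om | round_numbers m om = u] `&` [set om | observed m om = g]) =
    if rooted_labelling r g then (n.+1%:R^-1) ^+ n.+2 *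
      (reach ord0 * (\prod_i reach i) * tree_weight P T) * pr K else 0.
  case: ifP => hg; last first.
    apply: big1 => u _; rewrite (_ : _ `&` _ = set0) ?pr0//.
    apply/seteqP; split => // om [[[[_ hA] hE] hu] ho].
    by have [/(_ (conj hE ho))[]] := event_ET_observed r f g hu hA; rewrite hg.
  rewrite -(sum_round_weights f hg) mulrAC mulr_sumr; apply: eq_bigr => u _.
  rewrite mulrC -(pr_round_numbers u dK) -(@markov_chains m.+1 (fun=> start m)).
  - congr pr; apply/seteqP; split => om.
      move=> [[[hK hE] hu] ho]; split=> //.
      by have [/(_ (conj hE ho))[]] := event_ET_observed r f g hu hK.2.
    move=> [[hK hu] h].
    by have [_ /(_ (conj hg h))[hE ho]] := event_ET_observed r f g hu hK.2.
  - apply: determinedI; last exact: determined_round_numbers.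
    exact: determined_mono dK.
  - by move=> om [[_ /forallP hA] _] l; apply/eqP.
rewrite (eq_bigr _ (fun g _ => E g)) -big_mkcond sumr_const /round_const.
by rewrite -(card_rooted_labelling r) cardsE -mulr_natr; ring.
Qed.

Lemma tree_successor_graph T : T \in trees P -> exists r f, T = successor_graph r f.
Proof.
rewrite inE => /andP[/asboolP[r /arborescence_successor_graph[f ->]] _].
by exists r, f.
Qed.

(** The graph recorded in a round; it identifies the tree T of [event_ET]. *)
Definition edges m (om : Om) : {set state * state} :=
  [set (X l (start m + Defs.num U m l om)%N om,
        X l (start m + Defs.num U m l om).+1 om) | l : state & l != ord0]%SET.

Lemma event_ET_edges m T om : event_ET X U m T om -> edges m om = T.
Proof. by case/and4P => _ _ _ /eqP. Qed.

Lemma determined_edges m T :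
  determined m.+1 (fun=> start m.+1) [set om | edges m om = T].
Proof.
move=> om <- om' [h1 h2]; apply: eq_imset => l.
have hU j : U m j om' = U m j om by apply: h2.
rewrite /Defs.num hU !h1 // /round_start;
  by have := ltn_ord (U m (lift ord0 l) om); nia.
Qed.

Lemma event_EP m om :
  reflect (exists2 T, T \in trees P & event_ET X U m T om) (event_E P X U m om).
Proof.
apply: (iffP existsP) => [[T /andP[TP hT]]|[T TP hT]]; first by exists T.
by exists T; rewrite TP.
Qed.

Lemma determined_event_E m s : (forall l, start m.+1 <= s l)%N ->
  determined m.+1 s [set om | event_E P X U m om].
Proof.
move=> ms om /event_EP[T TP hT] om' p; apply/event_EP; exists T => //.
by rewrite (event_ET_past T (past_sub (leqnn _) ms p)).
Qed.

Lemma pr_event_E m H : determined m (fun=> start m) H ->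
  pr (H `&` [set om | event_E P X U m om]) =
  round_const * total_weight P * pr (H `&` [set om | event_A X m om]).
Proof.
move=> dH; have dE : determined m.+1 (fun=> start m.+1)
    (H `&` [set om | event_E P X U m om]).
  apply: determinedI; last exact: determined_event_E.
  by apply: determined_mono dH => // l; rewrite /round_start; nia.
have mT T := measurable_determined (@determined_edges m T).
rewrite (pr_partition _ (measurable_determined dE) mT).
rewrite (bigID (mem (trees P))) /= addrC big1 ?add0r; last first.
  move=> T TP; rewrite (_ : _ `&` _ = set0) ?pr0//.
  apply/seteqP; split => // om [[_ /event_EP[T' T'P /event_ET_edges eT']] eT].
  by move: TP; rewrite -eT eT' T'P.
rewrite /total_weight mulr_sumr mulr_suml; apply: eq_bigr => T TP.
have [r [f eT]] := tree_successor_graph TP.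
rewrite eT -pr_event_ET// -eT; congr pr; apply/seteqP; split => om.
  move=> [[hH /event_EP[T' T'P hT']] eT']; split=> //.
  by rewrite /= -eT' (event_ET_edges hT').
move=> [hH hT]; split; last exact: event_ET_edges.
by split=> //; apply/event_EP; exists T.
Qed.

Definition running m : set Om :=
  [set om | forall k, (k < m)%N -> ~~ event_E P X U k om].

Lemma determined_running m : determined m (fun=> start m) (running m).
Proof.
move=> om hr om' p k km; apply/negP => hE; have /negP := hr k km; apply.
have sk : (start k.+1 <= start m)%N by rewrite /round_start; nia.
exact: (determined_event_E (fun=> leqnn _) hE (past_sym (past_sub km (fun=> sk) p))).
Qed.

Lemma stopping_roundP m om :
  (stopping_round P X U om = Some m) <-> (running m om /\ event_E P X U m om).
Proof.
rewrite /stopping_round; case: pselect => [h|nh]; last first.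
  by split=> // -[_ hE]; case: nh; exists m.
case: ex_minnP => m' hE' min; split=> [[<-]|[hr hE]].
  by split=> // k km; apply/negP => /min; rewrite leqNgt km.
congr Some; apply/eqP; rewrite eqn_leq min //= leqNgt; apply/negP => mm.
by have := hr _ mm; rewrite hE'.
Qed.

Lemma tau_le (k : nat) om : (tau P X U om <= k%:R%:E)%E <->
  exists2 m, (@round_time n m <= k)%N & stopping_round P X U om = Some m.
Proof.
rewrite /tau; case: stopping_round => [m|]; last by split=> [|[]].
rewrite lee_fin ler_nat; split=> [mk|[m' mk [->]]//]; by exists m.
Qed.

Lemma output_eq m T om : T \in trees P -> stopping_round P X U om = Some m ->
  output P X U om = Some T <-> event_ET X U m T om.
Proof.
move=> TP sm; rewrite /output sm; case: pickP => [T' /andP[_ hT']|none].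
  split=> [[<-]//|hT]; congr Some.
  by rewrite -(event_ET_edges hT') (event_ET_edges hT).
by split=> // hT; have := none T; rewrite TP hT.
Qed.

Lemma event_ET_E m T om : T \in trees P -> event_ET X U m T om ->
  event_E P X U m om.
Proof. by move=> TP hT; apply/event_EP; exists T. Qed.

Lemma measurable_stop m : measurable (running m `&` [set om | event_E P X U m om]).
Proof.
apply: measurableI; first exact: measurable_determined (@determined_running m).
exact: measurable_determined (@determined_event_E m _ (fun=> leqnn _)).
Qed.

(** Both events are disjoint unions over the rounds that end by time k, and in
    each round the two probabilities are in the same ratio. *)
Lemma exact_sampling (k : nat) T : irreducible P -> T \in trees P ->
  Pr [set om | (tau P X U om <= k%:R%:E)%E /\ output P X U om = Some T] =
  (Pr [set om | (tau P X U om <= k%:R%:E)%E]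
   * (tree_weight P T / total_weight P)%:E)%E.
Proof.
move=> iP TP; pose D : set nat := [set m | (@round_time n m <= k)%N].
pose FT m := running m `&` [set om | event_ET X U m T om].
pose FE m := running m `&` [set om | event_E P X U m om].
have -> : [set om | (tau P X U om <= k%:R%:E)%E /\ output P X U om = Some T] =
    \bigcup_(m in D) FT m.
  apply/seteqP; split => om.
    move=> [/tau_le[m mk sm] /(output_eq TP sm) hT]; exists m => //.
    by split=> //; have /stopping_roundP[] := sm.
  move=> [m mk [hr hT]].
  have sm : stopping_round P X U om = Some m.
    by apply/stopping_roundP; split=> //; apply: event_ET_E hT.
  by split; [apply/tau_le; exists m|apply/(output_eq TP sm)].
have -> : [set om | (tau P X U om <= k%:R%:E)%E] = \bigcup_(m in D) FE m.
  apply/seteqP; split => om.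
    by move=> /tau_le[m mk /stopping_roundP sm]; exists m.
  by move=> [m mk sm]; apply/tau_le; exists m => //; apply/stopping_roundP.
have disj : trivIset D FE.
  move=> m m' _ _ [om [/stopping_roundP sm /stopping_roundP sm']].
  by move: sm; rewrite sm' => -[].
have FTE m : FT m `<=` FE m by move=> om [hr hT]; split=> //; apply: event_ET_E hT.
have mFT m : measurable (FT m).
  apply: measurableI; first exact: measurable_determined (@determined_running m).
  exact: measurable_determined (@determined_event_ET m T).
rewrite !measure_bigcup //; last 2 first.
- by move=> m _; apply: measurable_stop.
- move=> m m' Dm Dm' [om [h h']]; apply: disj => //.
  by exists om; split; apply: FTE.
rewrite muleC -nneseriesZl//; apply: eq_eseriesr => m _.
apply: etrans (prE Pr (mFT m)) _.
apply: etrans _ (congr1 (mule _) (esym (prE Pr (measurable_stop m)))).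
have [r [f eT]] := tree_successor_graph TP.
rewrite -EFinM; congr EFin.
rewrite /FT {1}eT pr_event_ET; last exact: determined_running.
rewrite /FE pr_event_E -?eT; last exact: determined_running.
have w0 : total_weight P != 0 by rewrite gt_eqF// total_weight_gt0.
by field.
Qed.

Lemma round_const_gt0 : irreducible P -> 0 < round_const.
Proof.
move=> iP; have reach_gt0 i : 0 < reach i.
  have [k hk] := power_gt0_reach tP iP ord0 i.
  rewrite /reach (bigD1 k) //= ltr_wpDr // sumr_ge0 // => j _.
  exact: power_ge0.
apply: mulr_gt0; first apply: mulr_gt0.
- by rewrite exprn_gt0 ?invr_gt0 ?ltr0n.
- by apply: mulr_gt0 => //; apply: prodr_gt0 => i _.
rewrite ltr0n card_gt0; apply/set0Pn; exists [ffun l => l].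
rewrite inE /rooted_labelling ffunE eqxx andbT; apply/injectiveP => x y.
by rewrite !ffunE.
Qed.

(** Given the states of the chains at the start of round m, they are all in state
    1 after h more rounds with a probability that is a product of n + 1 entries
    of a power of P. *)
Lemma event_A_lower_bound m h e H : determined m (fun=> start m) H ->
  0 <= e -> (forall i, e <= (P ^+ (2 * n.+1 * h)) i ord0) ->
  e ^+ n.+1 * pr H <= pr (H `&` [set om | event_A X (m + h) om]).
Proof.
move=> dH e0 he; pose Y om : {ffun state -> state} := [ffun l => X l (start m) om].
have dY y : determined m (fun=> start m) [set om | Y om = y].
  by move=> om <- om' [h1 _]; apply/ffunP => l; rewrite !ffunE h1.
have mY y := measurable_determined (dY y).
have mH := measurable_determined dH.
have mA : measurable [set om | event_A X (m + h) om].
  exact: measurable_determined (@determined_event_A (m + h) _ (fun=> leqnn _)).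
rewrite (pr_partition _ mH mY) (pr_partition _ (measurableI _ _ mH mA) mY).
rewrite mulr_sumr; apply: ler_sum => y _.
rewrite setIAC.
have -> : [set om | event_A X (m + h) om] =
    [set om | forall l, X l (start m + 2 * n.+1 * h)%N om = ord0 /\
                        X l (start m + 2 * n.+1 * h + 0)%N om = ord0].
  rewrite /event_A /round_start -mulnDr; apply/seteqP; split => om.
    by move=> /forallP hA l; rewrite addn0; split; apply/eqP.
  by move=> hA; apply/forallP => l; apply/eqP; have [] := hA l.
rewrite (@markov_chains m (fun=> start m) _ y (fun=> 2 * n.+1 * h)%N
  (fun=> 0%N) (fun=> ord0) (fun=> ord0)).
- rewrite ler_wpM2r ?pr_ge0// -[n.+1 in X in X <= _]card_ord -prodr_const.
  apply: ler_prod => l _; rewrite e0 expr0 mxE eqxx mulr1; exact: he.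
- exact: determinedI.
- by move=> om [_ <-] l; rewrite ffunE.
Qed.

(** Whatever the state after m rounds, event A holds h rounds later with
    probability at least e ^+ N, and that round is then successful with
    conditional probability round_const * total_weight. *)
Lemma running_decay : irreducible P -> aperiodic P ->
  exists q h, q < 1 /\ forall m, pr (running (m + h).+1) <= q * pr (running m).
Proof.
move=> iP aP; have [h0 hh] := power_eventually_gt0 tP iP ord0 aP.
pose e := \big[Num.min/1]_i ((P ^+ (2 * n.+1 * h0)) i ord0).
have e_gt0 : 0 < e.
  by apply: lt_bigmin => // i _; apply: hh; nia.
pose delta := round_const * total_weight P * e ^+ n.+1.
have delta_gt0 : 0 < delta.
  apply: mulr_gt0; last by rewrite exprn_gt0.
  apply: mulr_gt0; first exact: round_const_gt0.
  exact: total_weight_gt0.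
exists (1 - delta), h0; split=> [|m]; first by rewrite ltrBlDr ltrDl.
have dR : determined (m + h0) (fun=> start (m + h0)) (running m).
  apply: determined_mono (@determined_running m); first exact: leq_addr.
  by move=> l; rewrite /round_start; nia.
have mR := measurable_determined dR.
have mE := measurable_determined
  (@determined_event_E (m + h0) (fun=> start (m + h0).+1) (fun=> leqnn _)).
have mb (b : bool) : measurable [set om | event_E P X U (m + h0) om = b].
  case: b => //; rewrite (_ : mkset _ = ~` [set om | event_E P X U (m + h0) om]).
    exact: measurableC.
  by apply/seteqP; split => om /= => [->//|/negP/negbTE].
rewrite mulrBl mul1r lerBrDr.
rewrite [X in _ <= X](pr_partition _ mR mb) big_bool /= addrC lerD //; last first.
  rewrite (_ : delta * _ = round_const * total_weight P * (e ^+ n.+1 * pr (running m))).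
    rewrite pr_event_E// ler_wpM2l//.
      by apply/ltW/mulr_gt0; [apply: round_const_gt0|apply: total_weight_gt0].
    apply: event_A_lower_bound; rewrite ?(ltW e_gt0)//.
      exact: determined_running.
    by move=> i; apply: bigmin_le.
  by rewrite mulrA.
apply: le_pr.
- exact: measurable_determined (@determined_running _).
- exact: measurableI.
- move=> om hr; split => [k km|]; first by apply: hr; lia.
  by apply/negbTE/hr.
Qed.

Lemma tau_lt_oo om : (tau P X U om < +oo)%E <-> exists m, event_E P X U m om.
Proof.
rewrite /tau /stopping_round; case: pselect => [h|nh].
  by split=> // _; rewrite ltry.
by rewrite ltxx; split.
Qed.

Lemma termination : irreducible P -> aperiodic P ->
  Pr [set om | (tau P X U om < +oo)%E] = 1%E.
Proof.
move=> iP aP; have [q [h [q1 hq]]] := running_decay iP aP.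
have mR m := measurable_determined (@determined_running m).
pose never := \bigcap_m running m.
have mN : measurable never by apply: bigcapT_measurable.
have -> : [set om | (tau P X U om < +oo)%E] = ~` never.
  apply/seteqP; split => om.
    by move=> /tau_lt_oo[m hE] hN; have := hN m.+1 I m (leqnn _); rewrite hE.
  move=> hN; apply/tau_lt_oo; apply: contra_notP hN => nE m _ k _.
  by apply/negP => hE; apply: nE; exists k.
rewrite probability_setC// prE//; suff -> : pr never = 0 by rewrite sube0.
have q0 : 0 <= q.
  rewrite -[q]mulr1; have <- : pr (running 0) = 1.
    by rewrite (_ : running 0 = setT) ?prT//; apply/seteqP; split.
  by apply: le_trans (hq 0%N); apply: pr_ge0.
have bound j : pr never <= q ^+ j.
  apply: (@le_trans _ _ (pr (running (j * h.+1)))).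
    by apply: le_pr => // om; apply.
  elim: j => [|j IH]; first by rewrite expr0 pr_le1.
  rewrite mulSn addnC addnS exprS.
  exact: le_trans (hq _) (ler_wpM2l q0 IH).
apply/eqP; rewrite eq_le pr_ge0 andbT.
apply: (cvgr_to_ge (cvg_expr (z := q) _)); first by rewrite ger0_norm.
by apply: nearW => j; apply: bound.
Qed.

End Cylinders.

(** * The sampling theorem *)

Theorem theorem4p4 (R : realType) (n : nat) (P : 'M[R]_n.+1)
    (d : measure_display) (Om : measurableType d) (Pr : probability Om R)
    (X : 'I_n.+1 -> nat -> Om -> 'I_n.+1)
    (rho : {ffun 'I_n.+1 -> 'I_n.+1} -> R)
    (U : nat -> 'I_n.+2 -> Om -> 'I_n.+1) :
  transition_matrix P -> irreducible P ->
  (forall l t i, measurable [set om | X l t om = i]) ->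
  (forall m j i, measurable [set om | U m j om = i]) ->
  joint_distribution rho -> initial_law Pr X rho ->
  (forall l, markov_chain Pr P X l) ->
  cond_independent_chains Pr X ->
  uniform_numbers Pr U -> independent_numbers Pr X U ->
  (aperiodic P -> Pr [set om | (tau P X U om < +oo)%E] = 1%E)
  /\
  (forall (k : nat) (T : {set 'I_n.+1 * 'I_n.+1}), T \in trees P ->
     Pr [set om | (tau P X U om <= k%:R%:E)%E /\ output P X U om = Some T]
     = (Pr [set om | (tau P X U om <= k%:R%:E)%E]
        * (tree_weight P T / total_weight P)%:E)%E).
Proof.
move=> tP iP mX mU _ _ markovX indX unifU indU; split=> [aP|k T TP].
  exact: (termination tP mX mU markovX indX unifU indU iP aP).
exact: (exact_sampling tP mX mU markovX indX unifU indU k iP TP).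
Qed.
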